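(* Let $X$ be a strong $\sigma$-space and let $\mathcal C$ be a hereditary family of subsets of $X$. If $X$ has a countable locally quasi-uniform $\mathcal C^*$-netbase, then $X$ has a $\sigma$-discrete $\mathcal C^*$-network.
   Context: Regular means: every neighborhood of each point contains a closed neighborhood of that point. A family $\mathcal F$ of subsets of $X$ is discrete if each point of $X$ has a neighborhood meeting at most one member of $\mathcal F$; it is strongly discrete if each $F\in\mathcal F$ has an open neighborhood $U_F\supset F$ such that the family $(U_F)_{F\in\mathcal F}$ is discrete. A family is ($\sigma$-discrete) strongly $\sigma$-discrete if it is a countable union of (discrete) strongly discrete families. A family $\mathcal N$ is a network if for any open $U\subset X$ and $x\in U$ there is $N\in\mathcal N$ with $x\in N\subset U$. A strong $\sigma$-space is a regular $T_0$-space with a strongly $\sigma$-discrete network. A set $C\subset X$ accumulates at $x$ if every neighborhood of $x$ contains infinitely many points of $C$. The family $\mathcal C$ is hereditary if for any $C\in\mathcal C$ accumulating at a point $x\in X$ and any neighborhood $O_x$ of $x$ there is $C'\in\mathcal C$ with $C'\subset C\cap O_x$ and $C'$ accumulating at $x$. $\mathcal N$ is a $\mathcal C^*$-network at $x$ if for any neighborhood $O_x$ of $x$ and any $C\in\mathcal C$ accumulating at $x$ there is $N\in\mathcal N$ with $x\in N\subset O_x$ and $N\cap C$ infinite. $\mathcal N$ is a $\mathcal C^*$-network for $X$ if it is a network and a $\mathcal C^*$-network at each point. An entourage on $X$ is a subset $E\subset X\times X$ containing the diagonal; $E[x]=\{y:(x,y)\in E\}$, $UV=\{(x,z):\exists y\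 (x,y)\in U,\ (y,z)\in V\}$. An entourage base for $X$ is a family $\mathcal B$ of entourages such that (i) for all $B_1,B_2\in\mathcal B$ there is $B_3\in\mathcal B$ with $B_3\subset B_1\cap B_2$; (ii) for every $x\in X$ the family $\{B[x]:B\in\mathcal B\}$ is a neighborhood base at $x$. It is locally quasi-uniform if for every $x\in X$ and neighborhood $O_x$ of $x$ there is $B\in\mathcal B$ with $BB[x]\subset O_x$. A $\mathcal C^*$-netbase for $X$ is a pair $(\mathcal N,\mathcal B)$ with $\mathcal N$ a family of entourages on $X$ and $\mathcal B$ an entourage base for $X$ such that for every $B\in\mathcal B$ and $x\in X$ the family $\{N[x]:N\in\mathcal N,\ N\subset B\}$ is a $\mathcal C^*$-network at $x$. It is countable if $\mathcal N$ is countable, and locally quasi-uniform if $\mathcal B$ is. *)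

(* Defs.v *)
From mathcomp Require Import all_boot all_order.
From mathcomp Require Import boolp classical_sets functions cardinality filter.
From mathcomp Require Import topology.

Set Implicit Arguments.
Unset Strict Implicit.
Unset Printing Implicit Defensive.

Local Open Scope classical_set_scope.

Section Families.
Context {X : topologicalType}.
Implicit Types (F N : set (set X)) (C : set X) (x : X).

(* Discreteness is stated for indexed families: distinct indices whose members
   coincide count as distinct members, as needed for the expansions (U_A)_A
   below. *)
Definition discrete_family (I : Type) (D : set I) (f : I -> set X) : Prop :=
  forall x, exists2 O, nbhs x O &
    forall i j, D i -> D j ->
      f i `&` O !=set0 -> f j `&` O !=set0 -> i = j.

Definition discrete F : Prop := discrete_family F id.

Definition strongly_discrete F : Prop :=
  exists2 U : set X -> set X,
    forall A, F A -> open (U A) /\ A `<=` U A & discrete_family F U.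

Definition sigma_discrete F : Prop :=
  exists2 F_ : nat -> set (set X),
    forall n, discrete (F_ n) & F = \bigcup_n F_ n.

Definition strongly_sigma_discrete F : Prop :=
  exists2 F_ : nat -> set (set X),
    forall n, strongly_discrete (F_ n) & F = \bigcup_n F_ n.

Definition network N : Prop :=
  forall (U : set X) x, open U -> U x ->
    exists A, [/\ N A, A x & A `<=` U].

Definition accumulating_at C x : Prop :=
  forall O, nbhs x O -> infinite_set (C `&` O).

Definition hereditary (CC : set (set X)) : Prop :=
  forall C x O, CC C -> accumulating_at C x -> nbhs x O ->
    exists C', [/\ CC C', C' `<=` C `&` O & accumulating_at C' x].

Definition star_network_at (CC : set (set X)) N x : Prop :=
  forall O C, nbhs x O -> CC C -> accumulating_at C x ->
    exists A, [/\ N A, A x, A `<=` O & infinite_set (A `&` C)].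

Definition star_network (CC : set (set X)) N : Prop :=
  network N /\ forall x, star_network_at CC N x.

End Families.

Definition strong_sigma_space (X : topologicalType) : Prop :=
  [/\ regular_space X, kolmogorov_space X &
      exists2 N : set (set X), network N & strongly_sigma_discrete N].

Section Entourages.
Context {X : topologicalType}.
Implicit Types (N B : set (set (X * X))).

(* These entourages are only required to contain the diagonal; they are
   unrelated to [entourage] of a uniformType.  [xsection E x] is E[x]. *)
Definition is_entourage (E : set (X * X)) : Prop := diagonal `<=` E.

Definition nbhs_base (x : X) (S : set (set X)) : Prop :=
  (forall V, S V -> nbhs x V) /\
  (forall O, nbhs x O -> exists2 V, S V & V `<=` O).

Definition entourage_base B : Prop :=
  [/\ forall E, B E -> is_entourage E,
      forall E1 E2, B E1 -> B E2 -> exists2 E3, B E3 & E3 `<=` E1 `&` E2 &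
      forall x, nbhs_base x [set xsection E x | E in B]].

Definition locally_quasi_uniform B : Prop :=
  forall x O, nbhs x O ->
    exists2 E, B E & xsection (E \; E)%relation x `<=` O.

Definition star_netbase (CC : set (set X)) N B : Prop :=
  [/\ forall E, N E -> is_entourage E,
      entourage_base B &
      forall E x, B E ->
        star_network_at CC [set xsection M x | M in [set M | N M /\ M `<=` E]] x].

End Entourages.

(* Main.v *)
Require Import Defs.
From mathcomp Require Import all_boot all_order.
From mathcomp Require Import boolp classical_sets functions cardinality filter.
From mathcomp Require Import topology.

Local Open Scope classical_set_scope.

(** Let [D_ n] be the strongly discrete layers of a network of [X], and let
    [U n D] be the open expansion of a member [D] of the [n]-th layer.  For a
    set [M] of pairs write [M[D]] for the union of the sections [M[x]],
    [x \in D].  The required network consists of all sets [M[D] `&` U n D] with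
    [D] in [D_ n] and [M] either in the countable family [N] of the netbase or
    equal to the diagonal.

    For fixed [M] and [n] these sets form a discrete family, because the sets
    [U n D] do ([discrete_shrink]); as there are countably many pairs [(M, n)],
    the whole family is sigma-discrete ([sigma_discrete_bigcup]).  Taking [M]
    to be the diagonal gives back [D], so the family is a network.

    For the star condition at [x], fix a neighborhood [O] of [x] and a set [C]
    accumulating at [x].  Local quasi-uniformity gives a basic entourage [B]
    with [BB[x]] inside [O], and the original network gives [D] with [x] in [D]
    and [D] inside [B[x]].  Any [M] inside [B] then satisfies [M[D]] inside
    [BB[x]], hence inside [O].  Heredity allows [C] to be replaced by a smaller
    set [C'] lying in [U n D]; the netbase then provides [M] inside [B] with
    [M[x] `&` C'] infinite, and this intersection lies in
    [M[D] `&` U n D `&` C]. *)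

Section DiscreteFamilies.
Context {X : topologicalType}.
Implicit Types (F : set (set X)) (U g : set X -> set X).

(** Distinct indices [A] may give the same set [g A `&` U A]; such coincidences
    are harmless, since only the members of the image family are compared. *)
Lemma discrete_shrink F U g :
  discrete_family F U -> discrete [set g A `&` U A | A in F].
Proof.
move=> dU x; have [O Ox dO] := dU x; exists O => //.
move=> _ _ [A FA <-] [B FB <-] [y [[_ UAy] Oy]] [z [[_ UBz] Oz]].
by rewrite (dO A B FA FB _ _)//; [exists y | exists z].
Qed.

(** Sigma-discreteness asks for layers numbered by [nat]; an arbitrary countable
    index set is numbered injectively, and the unused numbers give empty
    layers. *)
Lemma sigma_discrete_bigcup (I : Type) (J : set I) (G : I -> set (set X)) :
  countable J -> (forall i, J i -> discrete (G i)) ->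
  sigma_discrete (\bigcup_(i in J) G i).
Proof.
move=> /countable_injP[f finj] dG.
exists (fun n => \bigcup_(i in J `&` f @^-1` [set n]) G i); last first.
  apply/seteqP; split=> A.
    by move=> [i Ji GA]; exists (f i) => //; exists i.
  by move=> [n _ [i [Ji _] GA]]; exists i.
move=> n x.
have [[i [Ji fi]]|nJ] := pselect (exists i, J i /\ f i = n); last first.
  exists setT; first exact: filterT.
  by move=> A B [i [Ji fi]] _ _; case: nJ; exists i.
have [O Ox dO] := dG i Ji x; exists O => //.
have eq_i j : J j -> f j = n -> j = i.
  by move=> Jj fj; apply: finj; rewrite ?inE// fj.
by move=> A B [j [Jj /(eq_i j Jj)->] GA] [k [Jk /(eq_i k Jk)->] GB]; exact: dO.
Qed.

End DiscreteFamilies.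

Section Saturation.
Context {X : Type}.
Implicit Types (M E : set (X * X)) (D : set X).

Definition saturation M D : set X := \bigcup_(x in D) xsection M x.

Lemma saturation_diagonal D : saturation diagonal D = D.
Proof.
apply/seteqP; split=> y; last by move=> Dy; exists y => //; apply/xsectionP.
by move=> [x Dx /xsectionP xy]; rewrite -(xy : x = y).
Qed.

Lemma saturation_sub_compose M E D x :
  M `<=` E -> D `<=` xsection E x ->
  saturation M D `<=` xsection (E \; E)%relation x.
Proof.
move=> ME DE z [y Dy /xsectionP Myz]; apply/xsectionP.
by exists y; [apply/xsectionP/DE | exact: ME].
Qed.

End Saturation.

Lemma countable_setU1 {T : Type} (A : set T) (a : T) :
  countable A -> countable (A `|` [set a]).
Proof.
by move=> cA; rewrite -bigcup2E; apply: bigcup_countable => // -[|[|i]] _ /=.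
Qed.

Theorem theorem5p1 (X : topologicalType) (CC : set (set X)) :
  strong_sigma_space X ->
  hereditary CC ->
  (exists N B : set (set (X * X)),
     [/\ star_netbase CC N B, countable N & locally_quasi_uniform B]) ->
  exists2 N : set (set X), sigma_discrete N & star_network CC N.
Proof.
move=> [_ _ [D netD [D_ sD eqD]]] her [N [B [[entN [_ _ baseB] starN] cN lqu]]].
rewrite {}eqD in netD.
have /choice[U UP] n : exists V : set X -> set X,
    (forall A, D_ n A -> open (V A) /\ A `<=` V A) /\ discrete_family (D_ n) V.
  by have [V] := sD n; exists V.
pose N' := N `|` [set diagonal].
pose G (p : set (X * X) * nat) :=
  [set saturation p.1 A `&` U p.2 A | A in D_ p.2].
have GP M n A : N' M -> D_ n A ->
    (\bigcup_(p in N' `*` [set: nat]) G p) (saturation M A `&` U n A).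
  by move=> NM DA; exists (M, n) => //=; exists A.
exists (\bigcup_(p in N' `*` [set: nat]) G p).
  apply: sigma_discrete_bigcup.
    by apply: countableX => //; exact: countable_setU1.
  by move=> [M n] _; apply: discrete_shrink; exact: (UP n).2.
split=> [O x oO Ox|x O C Ox CC_C accC].
  have [A [[n _ DA] Ax AO]] := netD O x oO Ox.
  exists (saturation diagonal A `&` U n A); split; first by apply: GP => //; right.
    by rewrite saturation_diagonal; split=> //; exact: ((UP n).1 A DA).2.
  by rewrite saturation_diagonal => y [/AO].
have [E BE EEO] := lqu x O Ox.
have nbhsEx : nbhs x (xsection E x) by apply: (baseB x).1; exists E.
have [A [[n _ DA] Ax AE]] : exists A, [/\ (\bigcup_n D_ n) A, A x &
    A `<=` (xsection E x)°].
  by apply: netD; [exact: open_interior | exact: nbhsEx].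
have [oU AU] := (UP n).1 A DA.
have nbhsU : nbhs x (U n A) by apply: open_nbhs_nbhs; split=> //; exact: AU.
(* [N] controls [M[x]] but not its intersection with [U n A], so [C] is first
   shrunk into [U n A]: the infinitely many points found then lie there. *)
have [C' [CC_C' C'CU accC']] := her C x (U n A) CC_C accC nbhsU.
have [_ [[M [NM ME] <-] _ _ infMC']] := starN E x BE setT C' filterT CC_C' accC'.
exists (saturation M A `&` U n A); split; first by apply: GP => //; left.
- split; last exact: AU.
  by exists x => //; apply/xsectionP; exact: (entN M NM).
- move=> y [My _]; apply/EEO; apply: saturation_sub_compose ME _ _ My.
  by apply: subset_trans AE _; exact: interior_subset.
- apply: sub_infinite_set infMC' => y [Mxy /C'CU[Cy Uy]].
  by split=> //; split=> //; exists x.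
Qed.
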